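(* Let $p\ge 1$, let $\Gamma:\Omega\to\mathcal{K}_c(\mathbb{R}^p)$ be a compact convex random set on a probability space $(\Omega,\mathcal{A},\mathbb{P})$, and let $K\in\mathcal{K}_c(\mathbb{R}^p)$. If $\Gamma$ is compact-symmetric with respect to $K$, then $$D_{CT}(K;\Gamma)=\sup_{L\in\mathcal{K}_c(\mathbb{R}^p)}D_{CT}(L;\Gamma).$$
   Context: $\mathcal{K}_c(\mathbb{R}^p)$ denotes the set of non-empty compact convex subsets of $\mathbb{R}^p$, and $\mathbb{S}^{p-1}=\{x\in\mathbb{R}^p:\|x\|=1\}$ the Euclidean unit sphere. The support function of $K\in\mathcal{K}_c(\mathbb{R}^p)$ is $s_K:\mathbb{S}^{p-1}\to\mathbb{R}$, $s_K(u)=\sup_{k\in K}\langle k,u\rangle$. A map $\Gamma:\Omega\to\mathcal{K}_c(\mathbb{R}^p)$ on a probability space $(\Omega,\mathcal{A},\mathbb{P})$ is a compact convex random set if $\{\omega\in\Omega:\Gamma(\omega)\cap K\ne\emptyset\}\in\mathcal{A}$ for all $K\in\mathcal{K}_c(\mathbb{R}^p)$; equivalently, it is Borel measurable with respect to the Hausdorff metric. Then $s_\Gamma(u)$, $\omega\mapsto s_{\Gamma(\omega)}(u)$, is a real random variable for each $u\in\mathbb{S}^{p-1}$. A real random variable $X$ is $C$-symmetric (centrally symmetric) with respect to $x\in\mathbb{R}$ if $X-x$ and $x-X$ are equally distributed. The random set $\Gamma$ is compact-symmetric with respect to $K\in\mathcal{K}_c(\mathbb{R}^p)$ if $s_\Gamma(u)$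 is $C$-symmetric with respect to $s_K(u)$ for all $u\in\mathbb{S}^{p-1}$. For $u\in\mathbb{S}^{p-1}$, $t\in\mathbb{R}$, define the halfspaces $S^-_{u,t}=\{K\in\mathcal{K}_c(\mathbb{R}^p):s_K(u)\le t\}$ and $S^+_{u,t}=\{K\in\mathcal{K}_c(\mathbb{R}^p):s_K(u)\ge t\}$. The Tukey depth of $K\in\mathcal{K}_c(\mathbb{R}^p)$ with respect to $\Gamma$ is $$D_{CT}(K;\Gamma)=\min\Big\{\inf_{u\in\mathbb{S}^{p-1},\,t\in\mathbb{R}:\ K\in S^-_{u,t}}\mathbb{P}(\Gamma\in S^-_{u,t}),\ \inf_{u\in\mathbb{S}^{p-1},\,t\in\mathbb{R}:\ K\in S^+_{u,t}}\mathbb{P}(\Gamma\in S^+_{u,t})\Big\}.$$ *)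

(* Defs.v *)
From HB Require Import structures.
From mathcomp Require Import all_boot all_order all_algebra.
From mathcomp Require Import all_classical all_reals all_analysis.
From mathcomp Require Import measurable_realfun.

Set Implicit Arguments.
Unset Strict Implicit.
Unset Printing Implicit Defensive.

Import Order.TTheory GRing.Theory Num.Theory.
Import numFieldNormedType.Exports.

Local Open Scope classical_set_scope.
Local Open Scope ring_scope.

Section convex_bodies.
Context {R : realType} {p : nat}.

Definition dotprod (x y : 'rV[R]_p) : R := \sum_(i < p) x ord0 i * y ord0 i.

(* The library norm on row vectors is the sup norm, hence the explicit
   Euclidean norm. *)
Definition euclidean_norm (x : 'rV[R]_p) : R := Num.sqrt (dotprod x x).

Definition unit_sphere : set 'rV[R]_p := [set u | euclidean_norm u = 1].

(* The topology of 'rV[R]_p is the product topology, so `compact` has its usual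
   meaning. *)
Record convex_body := ConvexBody {
  body :> set 'rV[R]_p;
  body_nonempty : body !=set0;
  body_compact : compact body;
  body_convex : convex_set (body : set (convex_lmodType 'rV[R]_p)) }.

(* The real-valued `sup` is the actual least upper bound here: the set is
   nonempty and bounded by compactness. It is only used for u in the unit sphere. *)
Definition support_fun (K : convex_body) (u : 'rV[R]_p) : R :=
  sup [set dotprod k u | k in (K : set 'rV[R]_p)].

Definition halfspace_le (u : 'rV[R]_p) (t : R) : set convex_body :=
  [set K | support_fun K u <= t].

Definition halfspace_ge (u : 'rV[R]_p) (t : R) : set convex_body :=
  [set K | t <= support_fun K u].

End convex_bodies.

Arguments unit_sphere : clear implicits.
Arguments convex_body : clear implicits.

Record random_convex_body d (T : measurableType d) (R : realType) (p : nat) :=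
  RandomConvexBody {
    rcb_fun :> T -> convex_body R p;
    rcb_measurable : forall K : convex_body R p,
      measurable [set w | (rcb_fun w `&` K) !=set0] }.

Section support_measurable.
Context {R : realType} {p : nat}.

Lemma dotprod_continuous (u : 'rV[R]_p) : continuous (dotprod ^~ u).
Proof.
rewrite /dotprod; elim: (index_enum _) => [|i s ih].
  suff -> : (fun y : 'rV[R]_p => \sum_(j <- [::]) y ord0 j * u ord0 j) = cst 0.
    exact: cst_continuous.
  by apply/funext => y; rewrite big_nil.
have -> : (fun y : 'rV[R]_p => \sum_(j <- i :: s) y ord0 j * u ord0 j) =
    (fun y => y ord0 i * u ord0 i + \sum_(j <- s) y ord0 j * u ord0 j).
  by apply/funext => y; rewrite big_cons.
move=> x.
have ci : {for x, continuous (fun y : 'rV[R]_p => y ord0 i)}.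
  exact: coord_continuous.
have cu : {for x, continuous (cst (u ord0 i) : 'rV[R]_p -> R)}.
  exact: cst_continuous.
exact: (cvgD (continuousM ci cu) (ih x)).
Qed.

Lemma dotprodDl (a b u : 'rV[R]_p) :
  dotprod (a + b) u = dotprod a u + dotprod b u.
Proof. by rewrite -big_split; apply: eq_bigr => i _; rewrite mxE mulrDl. Qed.

Lemma dotprodZl (c : R) (a u : 'rV[R]_p) : dotprod (c *: a) u = c * dotprod a u.
Proof. by rewrite mulr_sumr; apply: eq_bigr => i _; rewrite mxE mulrA. Qed.

Lemma support_attained (K : convex_body R p) (u : 'rV[R]_p) :
  exists2 k, body K k & support_fun K u = dotprod k u /\
    forall x, body K x -> dotprod x u <= support_fun K u.
Proof.
have [|k Kk kmax] := EVT_max_rV (body_nonempty K) (@body_compact _ _ K)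
  (f := dotprod ^~ u).
  by apply: continuous_subspaceT; exact: dotprod_continuous.
rewrite inE in Kk.
have sE : support_fun K u = dotprod k u.
  apply/eqP; rewrite eq_le; apply/andP; split.
    apply: ge_sup; first by exists (dotprod k u), k.
    by move=> _ [x Kx <-]; apply: kmax; rewrite inE.
  apply: ub_le_sup; last by exists k.
  by exists (dotprod k u) => _ [x Kx <-]; apply: kmax; rewrite inE.
by exists k => //; split=> // x Kx; rewrite sE; apply: kmax; rewrite inE.
Qed.

Let slab (u : 'rV[R]_p) (t : R) (n : nat) : set 'rV[R]_p :=
  [set x | t <= dotprod x u] `&` [set x | `|x| <= n%:R].

Lemma slab_compact u t n : compact (slab u t n).
Proof.
apply: bounded_closed_compact.
  exists n%:R; split; first exact: num_real.
  by move=> x nx y [_ /= yn]; exact: le_trans yn (ltW nx).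
apply: closedI.
  apply: (@preimage_closed _ _ _ [set y | t <= y]); last exact: closed_ge.
  by move=> x _; exact: dotprod_continuous.
apply: (@preimage_closed _ _ (fun x : 'rV[R]_p => `|x|) [set y | y <= n%:R]);
  last exact: closed_le.
by move=> x _; exact: norm_continuous.
Qed.

Lemma slab_convex u t n :
  convex_set (slab u t n : set (convex_lmodType 'rV[R]_p)).
Proof.
move=> x y l; rewrite !inE => -[/= tx xn] [/= ty yn].
have l0 : 0 <= l%:num by [].
have l1 : 0 <= 1 - l%:num by rewrite subr_ge0.
split => /=; rewrite /conv/=.
  rewrite dotprodDl !dotprodZl.
  rewrite (_ : t = l%:num * t + (1 - l%:num) * t); last first.
    by rewrite -mulrDl addrC subrK mul1r.
  by apply: lerD; exact: ler_wpM2l.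
rewrite (_ : n%:R = l%:num * n%:R + (1 - l%:num) * n%:R); last first.
  by rewrite -mulrDl addrC subrK mul1r.
apply: (le_trans (ler_normD _ _)); rewrite !normrZ !ger0_norm//.
by apply: lerD; exact: ler_wpM2l.
Qed.

Lemma support_measurable d (T : measurableType d)
    (Gamma : random_convex_body T R p) (u : 'rV[R]_p) :
  measurable_fun [set: T] (fun w => support_fun (Gamma w) u).
Proof.
move=> mT; apply: (measurability _ (RGenCInfty.measurableE R)) => //.
move=> _ [_ [t ->] <-]; rewrite setTI.
rewrite (_ : _ @^-1` _ =
  \bigcup_n [set w | (Gamma w `&` slab u t n) !=set0]); last first.
  apply/seteqP; split=> w /=; rewrite in_itv/= andbT.
    have [k Gk [-> _]] := support_attained (Gamma w) u.
    move=> tk; exists (Num.truncn `|k|).+1 => //; exists k; split => //.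
    by split => //=; apply/ltW/truncnS_gt.
  move=> [n _ [x [Gx [/= tx _]]]].
  have [_ _ [_ /(_ _ Gx)]] := support_attained (Gamma w) u.
  exact: le_trans.
apply: bigcupT_measurable => n.
have [slab0|/set0P slab0] := eqVneq (slab u t n) set0.
  rewrite (_ : mkset _ = set0)//.
  by apply/seteqP; split => w //= -[x []]; rewrite slab0.
exact: (rcb_measurable Gamma
  (ConvexBody slab0 (@slab_compact u t n) (@slab_convex u t n))).
Qed.

End support_measurable.

Definition support_rv d (T : measurableType d) (R : realType) (p : nat)
  (Gamma : random_convex_body T R p) (u : 'rV[R]_p) : T -> R :=
  fun w => support_fun (Gamma w) u.

HB.instance Definition _ d (T : measurableType d) (R : realType) (p : nat)
  (Gamma : random_convex_body T R p) (u : 'rV[R]_p) :=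
  isMeasurableFun.Build _ _ _ _ (support_rv Gamma u) (support_measurable Gamma u).

Section symmetry_and_depth.
Context d (T : measurableType d) (R : realType) (P : probability T R).

(* Laws are compared on measurable sets only, as the value of a library measure
   on a nonmeasurable set carries no meaning. *)
Definition C_symmetric (X : {RV P >-> R}) (x : R) : Prop :=
  forall A : set R, measurable A ->
    distribution P (X \- cst x) A =
    distribution P (cst x \- X) A.

Context (p : nat) (Gamma : random_convex_body T R p).

Definition compact_symmetric (K : convex_body R p) : Prop :=
  forall u, unit_sphere R p u -> C_symmetric (support_rv Gamma u) (support_fun K u).

Definition tukey_depth (K : convex_body R p) : \bar R :=
  Order.min
    (ereal_inf [set P (Gamma @^-1` halfspace_le ut.1 ut.2) | ut in
       [set ut : 'rV[R]_p * R | unit_sphere R p ut.1 /\ halfspace_le ut.1 ut.2 K]])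
    (ereal_inf [set P (Gamma @^-1` halfspace_ge ut.1 ut.2) | ut in
       [set ut : 'rV[R]_p * R | unit_sphere R p ut.1 /\ halfspace_ge ut.1 ut.2 K]]).

End symmetry_and_depth.

(* Main.v *)
Require Import Defs.
From mathcomp Require Import all_boot all_order all_algebra.
From mathcomp Require Import all_classical all_reals all_analysis.

Import Order.TTheory GRing.Theory Num.Theory.

Local Open Scope classical_set_scope.

(** If [Gamma] is compact-symmetric about [K], reflecting the law of its support
    variable in direction [u] about the support value of [K] exchanges the two
    closed halfspaces of direction [u] that have [K] on their boundary, so these
    have the same probability ([prob_boundary_halfspaces]).

    Let [L] be any other convex body. A halfspace containing [K] either contains
    [L], and then its probability bounds the depth of [L] directly, or excludes
    [L]. In the second case [L] lies in the opposite halfspace bounded by [K],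
    whose probability thus bounds the depth of [L]; by symmetry this is the
    probability of the halfspace bounded by [K] on the original side, which is
    included in the given one. Hence every probability entering the depth of
    [K] is at least the depth of [L]. *)

Local Open Scope ring_scope.

Section tukey_depth_at_center.
Context (R : realType) (p : nat) (d : measure_display) (Omega : measurableType d).
Context (P : probability Omega R) (Gamma : random_convex_body Omega R p).
Implicit Types (K L : convex_body R p) (u : 'rV[R]_p) (t : R).

Lemma measurable_halfspace_le u t : measurable (Gamma @^-1` halfspace_le u t).
Proof.
rewrite -[X in measurable X]setTI.
have -> : Gamma @^-1` halfspace_le u t = support_rv Gamma u @^-1` `]-oo, t].
  by apply/seteqP; split=> w /=; rewrite in_itv.
exact: support_measurable.
Qed.

Lemma measurable_halfspace_ge u t : measurable (Gamma @^-1` halfspace_ge u t).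
Proof.
rewrite -[X in measurable X]setTI.
have -> : Gamma @^-1` halfspace_ge u t = support_rv Gamma u @^-1` `[t, +oo[.
  by apply/seteqP; split=> w /=; rewrite in_itv/= andbT.
exact: support_measurable.
Qed.

Lemma tukey_depth_le_halfspace_le L u t :
  unit_sphere R p u -> halfspace_le u t L ->
  (tukey_depth P Gamma L <= P (Gamma @^-1` halfspace_le u t))%E.
Proof.
move=> Su Lt; rewrite /tukey_depth ge_min; apply/orP; left.
by apply: ereal_inf_lbound; exists (u, t).
Qed.

Lemma tukey_depth_le_halfspace_ge L u t :
  unit_sphere R p u -> halfspace_ge u t L ->
  (tukey_depth P Gamma L <= P (Gamma @^-1` halfspace_ge u t))%E.
Proof.
move=> Su Lt; rewrite /tukey_depth ge_min; apply/orP; right.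
by apply: ereal_inf_lbound; exists (u, t).
Qed.

(** Central symmetry evaluated on the nonpositive half-line. *)
Lemma prob_boundary_halfspaces K u :
  compact_symmetric P Gamma K -> unit_sphere R p u ->
  P (Gamma @^-1` halfspace_le u (support_fun K u)) =
  P (Gamma @^-1` halfspace_ge u (support_fun K u)).
Proof.
move=> symK Su.
have := symK u Su [set` `]-oo, 0]] (measurable_itv _).
rewrite /distribution /pushforward /=.
congr (P _ = P _); apply/seteqP; split=> w /=;
  by rewrite in_itv/= /support_rv subr_le0.
Qed.

Lemma tukey_depth_le_center K L :
  compact_symmetric P Gamma K ->
  (tukey_depth P Gamma L <= tukey_depth P Gamma K)%E.
Proof.
move=> symK; rewrite {2}/tukey_depth le_min; apply/andP; split;
  apply: le_ereal_inf_tmp => _ [[u t] /= [Su Kt] <-].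
- have [Lt|/ltW tL] := leP (support_fun L u) t.
    exact: tukey_depth_le_halfspace_le.
  have KL : halfspace_ge u (support_fun K u) L by exact: le_trans tL.
  apply: (le_trans (tukey_depth_le_halfspace_ge _ _ _ Su KL)).
  rewrite -prob_boundary_halfspaces//.
  apply: le_measure; rewrite ?inE; try exact: measurable_halfspace_le.
  by move=> w /= /le_trans; apply.
- have [Lt|/ltW tL] := leP t (support_fun L u).
    exact: tukey_depth_le_halfspace_ge.
  have LK : halfspace_le u (support_fun K u) L by exact: le_trans Kt.
  apply: (le_trans (tukey_depth_le_halfspace_le _ _ _ Su LK)).
  rewrite prob_boundary_halfspaces//.
  apply: le_measure; rewrite ?inE; try exact: measurable_halfspace_ge.
  by move=> w /=; exact: le_trans.
Qed.

End tukey_depth_at_center.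

Local Close Scope ring_scope.

Theorem proposition4p4 (R : realType) (p : nat) (hp : (1 <= p)%N)
  (d : measure_display) (Omega : measurableType d) (P : probability Omega R)
  (Gamma : random_convex_body Omega R p) (K : convex_body R p) :
  compact_symmetric P Gamma K ->
  tukey_depth P Gamma K =
  ereal_sup [set tukey_depth P Gamma L | L in [set: convex_body R p]].
Proof.
move=> symK; apply/eqP; rewrite eq_le; apply/andP; split.
  by apply: ereal_sup_ubound; exists K.
by apply: ge_ereal_sup => _ [L _ <-]; exact: tukey_depth_le_center.
Qed.
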